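(* Let $m\ge2$ be an integer, let $\alpha_m$ be the unique positive root of $z^m-z^{m-1}-\dots-z-1$, and let $d_m=\dfrac{\alpha_m-1}{2+(m+1)(\alpha_m-2)}$. Then (1) $d_m\alpha_m^t-\frac12\le|L_{4t,m}\cap R_{4t}|\le d_m\alpha_m^t+\frac12$ for all integers $t\ge1$; (2) $|L_{4t,m}\cap R_{4t}|\sim d_m\alpha_m^t$ as $t\to\infty$.
   Context: $G=\mathbb{Z}_2*\mathbb{Z}_3$, where $a$ generates $\mathbb{Z}_2$ and $b$ generates $\mathbb{Z}_3$. The word length of an element of $G$ is the minimum length of a word in $\{a,b,b^{-1}\}$ representing it; the length of a conjugacy class is the minimum word length of its elements. The set of reciprocal words is $\mathcal{R}=\{xy: x,y\text{ distinct order 2 elements of }G\}$, and $R_{4t}$ is the set of conjugacy classes of elements of $\mathcal{R}$ of length $4t$. Every infinite order element is conjugate to an (ab)-word $ab^{\epsilon_1}\cdots ab^{\epsilon_s}$, $\epsilon_i=\pm1$, unique up to cyclic permutation of $(\epsilon_1,\dots,\epsilon_s)$; it is $m$-low lying if no $m+1$ consecutive $\epsilon_i$, considered cyclically, have the same sign. $L_{4t,m}$ is the set of conjugacy classes of $m$-low lying words of length $4t$. $f\sim g$ means $f(t)/g(t)\to1$. *)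

(* Defs.v *)
From HB Require Import structures.
From mathcomp Require Import all_boot all_order all_fingroup all_algebra.
From mathcomp Require Import finmap all_classical all_reals all_analysis.
Import Order.TTheory GRing.Theory Num.Theory.
Import numFieldNormedType.Exports.

Set Implicit Arguments.
Unset Strict Implicit.
Unset Printing Implicit Defensive.

Local Open Scope classical_set_scope.
Local Open Scope group_scope.

(* The free product G * H, realised as the group of reduced words: sequences  *)
(* of nontrivial syllables taken alternately from G and H. [free_product_univ]*)
(* is its universal property.                                                 *)
Section FreeProduct.
Variables G H : groupType.
Local Notation syl := (G + H)%type.
Implicit Types (x y z : syl) (s t u : seq syl).

Definition syl_trivial x : bool :=
  match x with inl g => g == 1 | inr h => h == 1 end.

Definition syl_mul x y : option syl :=
  match x, y with
  | inl g, inl g' => Some (inl (g * g'))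
  | inr h, inr h' => Some (inr (h * h'))
  | _, _ => None
  end.

Definition syl_inv x : syl :=
  match x with inl g => inl g^-1 | inr h => inr h^-1 end.

Definition reduced s : bool :=
  all (fun x => ~~ syl_trivial x) s && sorted (fun x y => ~~ syl_mul x y) s.

Definition word_cons x s : seq syl :=
  if syl_trivial x then s else
  if s is y :: s' then
    if syl_mul x y is Some z then if syl_trivial z then s' else z :: s'
    else x :: s
  else [:: x].

Definition word_mul s t : seq syl := foldr word_cons t s.

Definition word_inv s : seq syl := rev (map syl_inv s).

Record free_product := FreeProduct {
  fp_word :> seq syl;
  fp_reduced : reduced fp_word }.

HB.instance Definition _ := [isSub for fp_word].
HB.instance Definition _ := [Choice of free_product by <:].

Lemma reduced_cons x s :
  reduced (x :: s) =
  [&& ~~ syl_trivial x, (if s is y :: _ then ~~ syl_mul x y else true)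
    & reduced s].
Proof.
by rewrite /reduced /=; case: s => [|y s] /=;
   rewrite ?andbT -?andbA //; do !bool_congr.
Qed.

Lemma reduced_word_cons x s : reduced s -> reduced (word_cons x s).
Proof.
rewrite /word_cons; case: ifPn => // nx; case: s => [|y s] rs.
  by rewrite reduced_cons nx.
case E: (syl_mul x y) => [z|]; last by rewrite reduced_cons nx E rs.
move: rs; rewrite reduced_cons => /and3P[ny ys rs].
case: ifPn => // nz; rewrite reduced_cons nz rs andbT.
case: s ys {rs} => // w s.
by case: x y z w E {nx ny nz} => [?|?] [?|?] [?|?] [?|?].
Qed.

Lemma reduced_word_mul s t : reduced t -> reduced (word_mul s t).
Proof. by move=> rt; elim: s => //= x s; apply: reduced_word_cons. Qed.

Lemma syl_trivial_inv x : syl_trivial (syl_inv x) = syl_trivial x.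
Proof. by case: x => g /=; rewrite invg_eq1. Qed.

Lemma reduced_word_inv s : reduced s -> reduced (word_inv s).
Proof.
case/andP=> ns as_; apply/andP; split; rewrite /word_inv.
  by rewrite all_rev all_map; under eq_all => x do rewrite /= syl_trivial_inv.
rewrite rev_sorted sorted_map; apply: sub_sorted as_ => x y /=.
by case: x y => [?|?] [?|?].
Qed.

Let foreign x s : bool := if s is y :: _ then ~~ syl_mul x y else true.
Let put x s := if syl_trivial x then s else x :: s.

Let cons_put x y z s : foreign x s -> syl_mul x y = Some z ->
  word_cons x (put y s) = put z s.
Proof.
have foreignE w t : foreign w t -> word_cons w t = put w t.
  rewrite /word_cons /put; case: ifP => // _; case: t => //= v t.
  by case: (syl_mul w v).
move=> fs xy; rewrite {1}/put; case: ifPn => [y1|ny].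
  by case: x y z y1 xy fs => [g|g] [h|h] //= z /eqP -> [<-]; rewrite mulg1 => /foreignE.
rewrite /word_cons xy; case: ifPn => [x1|nx]; last by [].
case: x y z x1 xy ny {fs} => [g|g] [h|h] //= z /eqP -> [<-] nh.
all: by rewrite mul1g /put /= (negPf nh).
Qed.

Let put_ex x s : reduced s -> exists y t,
  [/\ foreign x t, s = put y t & syl_mul x y].
Proof.
pose e := if x is inl _ then inl 1 else inr 1 : syl.
have ee : syl_trivial e && syl_mul x e by rewrite /e; case: (x) => ? /=; rewrite eqxx.
case/andP: ee => e1 xe.
have pe t : t = put e t by rewrite /put e1.
case: s => [|y s]; first by exists e, [::].
rewrite reduced_cons => /and3P[ny ys rs].
case xy: (syl_mul x y) => [z|]; last first.
  by exists e, (y :: s); split=> //=; rewrite xy.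
exists y, s; split=> //; rewrite ?/put ?(negPf ny) ?xy //.
by case: s ys {rs} => //= w s; case: x y w xy {e e1 xe pe ny} => [?|?] [?|?] [?|?].
Qed.

Lemma word_consM x y z s : reduced s -> syl_mul x y = Some z ->
  word_cons x (word_cons y s) = word_cons z s.
Proof.
move=> rs xy; have [w [t [ft -> xw]]] := put_ex x rs.
have same (v : syl) : syl_mul y v = syl_mul x v :> bool.
  by case: x y v xy {ft xw} => [?|?] [?|?] [?|?].
have fy : foreign y t by case: t ft => //= u t; rewrite same.
have yw : syl_mul y w by rewrite same.
case E: (syl_mul y w) yw => [v|] // _; rewrite (cons_put fy E).
have [r xv zw] : exists2 r, syl_mul x v = Some r & syl_mul z w = Some r.
  case: x y z w v xy E {ft xw same fy} => [?|?] [?|?] z [?|?] v //= [<-] [<-];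
    by eexists; rewrite /= ?mulgA.
have fz : foreign z t.
  case: t ft {fy} => //= v' t.
  by case: x y z xy v' {xw same E xv zw} => [?|?] [?|?] z //= [<-] [?|?].
by rewrite (cons_put ft xv) (cons_put fz zw).
Qed.

Lemma word_cons_trivial x s : syl_trivial x -> word_cons x s = s.
Proof. by rewrite /word_cons => ->. Qed.

Lemma word_mulA s t u : reduced u ->
  word_mul s (word_mul t u) = word_mul (word_mul s t) u.
Proof.
move=> ru; elim: s => //= x s ->; move: (word_mul s t) => {s t}r.
rewrite {2}/word_cons; case: ifPn => [x1|nx]; first by rewrite word_cons_trivial.
case: r => [|y r] //; case E: (syl_mul x y) => [z|] //.
rewrite /= (word_consM (reduced_word_mul r ru) E).
by case: ifPn => // z1; rewrite word_cons_trivial.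
Qed.

Lemma word_muls0 s : reduced s -> word_mul s [::] = s.
Proof.
elim: s => //= x s IH; rewrite reduced_cons => /and3P[nx xs rs].
rewrite IH // /word_cons (negPf nx); case: s xs {IH rs} => // y s.
by case: (syl_mul x y).
Qed.

Lemma word_mulVs s : reduced s -> word_mul (word_inv s) s = [::].
Proof.
elim: s => //= x s IH rxs; move: (rxs); rewrite reduced_cons => /and3P[nx xs rs].
rewrite /word_inv /= rev_cons /word_mul -cats1 foldr_cat /=.
suff -> : word_cons (syl_inv x) (x :: s) = s by exact: IH.
rewrite /word_cons syl_trivial_inv (negPf nx).
by case: x {rxs nx xs} => g /=; rewrite mulVg eqxx.
Qed.

Definition fp_one : free_product := @FreeProduct [::] isT.

Definition fp_mul (p q : free_product) : free_product :=
  FreeProduct (reduced_word_mul p (fp_reduced q)).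

Definition fp_inv (p : free_product) : free_product :=
  FreeProduct (reduced_word_inv (fp_reduced p)).

Lemma fp_mulA : associative fp_mul.
Proof. by move=> p q r; apply/val_inj/word_mulA/fp_reduced. Qed.

Lemma fp_mul1 : left_id fp_one fp_mul.
Proof. by move=> p; apply/val_inj. Qed.

Lemma fp_mulr1 : right_id fp_one fp_mul.
Proof. by move=> p; apply/val_inj/word_muls0/fp_reduced. Qed.

Lemma fp_mulV : left_inverse fp_one fp_inv fp_mul.
Proof. by move=> p; apply/val_inj/word_mulVs/fp_reduced. Qed.

Lemma fp_mulrV : right_inverse fp_one fp_inv fp_mul.
Proof.
move=> p; rewrite -[LHS]fp_mul1 -(fp_mulV (fp_inv p)) -fp_mulA.
by rewrite (fp_mulA (fp_inv p)) fp_mulV fp_mul1.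
Qed.

HB.instance Definition _ :=
  isGroup.Build free_product fp_mulA fp_mul1 fp_mulr1 fp_mulV fp_mulrV.

Definition fp_syl x : free_product :=
  FreeProduct (reduced_word_cons x (isT : reduced [::])).

Definition fp_inl (g : G) : free_product := fp_syl (inl g).
Definition fp_inr (h : H) : free_product := fp_syl (inr h).

Lemma fp_inlM : {morph fp_inl : g h / g * h}.
Proof.
move=> g h; apply/val_inj => /=; rewrite /word_mul /word_cons /=.
case: (eqVneq g 1) => [->|ng] /=; first by rewrite mul1g.
case: (eqVneq h 1) => [->|nh] /=; first by rewrite mulg1 (negPf ng).
by rewrite (negPf ng).
Qed.

Lemma fp_inrM : {morph fp_inr : g h / g * h}.
Proof.
move=> g h; apply/val_inj => /=; rewrite /word_mul /word_cons /=.
case: (eqVneq g 1) => [->|ng] /=; first by rewrite mul1g.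
case: (eqVneq h 1) => [->|nh] /=; first by rewrite mulg1 (negPf ng).
by rewrite (negPf ng).
Qed.

Lemma fp_prod (p : free_product) : p = \prod_(x <- p) fp_syl x.
Proof.
case: p => s rs /=; elim: s rs => [|x s IH] rs; apply/val_inj => /=.
  by rewrite big_nil.
move: (rs); rewrite reduced_cons => /and3P[nx xs rs'].
rewrite big_cons -(IH rs') /= {1}/word_cons (negPf nx) /= /word_cons (negPf nx).
by case: s xs {IH rs rs'} => // y s; case: (syl_mul x y).
Qed.

Lemma free_product_univ (K : groupType) (f : G -> K) (g : H -> K) :
  {morph f : x y / x * y} -> {morph g : x y / x * y} ->
  exists! F : free_product -> K,
    [/\ {morph F : x y / x * y}, F \o fp_inl = f & F \o fp_inr = g].
Proof.
move=> fM gM.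
have f1 : f 1 = 1 by apply: (mulgI (f 1)); rewrite -fM !mulg1.
have g1 : g 1 = 1 by apply: (mulgI (g 1)); rewrite -gM !mulg1.
pose ev (x : syl) : K := match x with inl a => f a | inr b => g b end.
pose E (s : seq syl) : K := \prod_(x <- s) ev x.
have ev_triv x : syl_trivial x -> ev x = 1 by case: x => a /= /eqP ->.
have Econs x s : E (word_cons x s) = ev x * E s.
  rewrite /word_cons; case: ifPn => [/ev_triv ->|_]; first by rewrite mul1g.
  case: s => [|y s]; first by rewrite /E big_seq1 big_nil mulg1.
  case xy: (syl_mul x y) => [z|]; last by rewrite /E big_cons.
  have evz : ev z = ev x * ev y.
    by case: x y xy => [?|?] [?|?] //= [<-]; rewrite /= ?fM ?gM.
  rewrite [in RHS]/E big_cons mulgA -evz.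
  by case: ifPn => [/ev_triv ->|_]; rewrite ?mul1g // /E big_cons.
exists (fun p => E p); split; first split.
- move=> p q /=; elim: (fp_word p) => [|x s IH] /=; first by rewrite /E big_nil mul1g.
  by rewrite Econs IH [in RHS]/E big_cons -mulgA.
- by apply/funext => a /=; rewrite Econs /E big_nil mulg1.
- by apply/funext => a /=; rewrite Econs /E big_nil mulg1.
move=> F [FM Fl Fr]; apply/funext => p; rewrite [in RHS](fp_prod p).
have F1 : F 1 = 1 by apply: (mulgI (F 1)); rewrite -FM !mulg1.
rewrite (big_morph F FM F1); apply: eq_bigr => -[a|a] _ /=.
  by rewrite -Fl.
by rewrite -Fr.
Qed.

End FreeProduct.

(* The group law of ['Z_n] in [group_scope] is addition modulo [n], so [Zp1]   *)
(* is a generator.                                                            *)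
Definition Z2Z3 : groupType := free_product 'Z_2 'Z_3.

Definition gen_a : Z2Z3 := fp_inl _ (Zp1 : 'Z_2).
Definition gen_b : Z2Z3 := fp_inr _ (Zp1 : 'Z_3).

Definition word_for (x : Z2Z3) (w : seq Z2Z3) : Prop :=
  {subset w <= [:: gen_a; gen_b; gen_b^-1]} /\ \prod_(y <- w) y = x.

Lemma word_ex (x : Z2Z3) : exists n, `[< exists2 w, word_for x w & size w = n >].
Proof.
suff [w wx] : exists w, word_for x w by exists (size w); apply/asboolP; exists w.
rewrite (fp_prod x); elim: (fp_word x) => [|y s [w [wg wx]]].
  by exists [::]; rewrite /word_for !big_nil.
have [v [vg vy]] : exists v, word_for (fp_syl y) v.
  have eqg (p q : Z2Z3) : fp_word p == fp_word q -> p = q by move/eqP/val_inj.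
  case: y => -[[|[|[|k]]] lt_k] //.
  - by exists [::]; split=> //; rewrite big_nil; apply: eqg.
  - exists [:: gen_a]; split; last by rewrite big_seq1; apply: eqg.
    by move=> z; rewrite !inE => ->.
  - by exists [::]; split=> //; rewrite big_nil; apply: eqg.
  - exists [:: gen_b]; split; last by rewrite big_seq1; apply: eqg.
    by move=> z; rewrite !inE => ->; rewrite orbT.
  - exists [:: gen_b^-1]; split; last by rewrite big_seq1; apply: eqg.
    by move=> z; rewrite !inE => ->; rewrite !orbT.
exists (v ++ w); split; last by rewrite big_cat big_cons /= vy wx.
by move=> z; rewrite mem_cat => /orP[/vg|/wg].
Qed.

Definition word_length (x : Z2Z3) : nat := ex_minn (word_ex x).

Definition conj_class (x : Z2Z3) : set Z2Z3 := [set x ^ g | g in setT].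

Lemma class_length_ex (x : Z2Z3) :
  exists n, `[< exists2 y, conj_class x y & word_length y = n >].
Proof.
by exists (word_length x); apply/asboolP; exists x => //; exists 1; rewrite ?conjg1.
Qed.

(* The length of the conjugacy class of [x]. *)
Definition class_length (x : Z2Z3) : nat := ex_minn (class_length_ex x).

Definition order2 (x : Z2Z3) : Prop := x != 1 /\ x ^+ 2 = 1.

Definition reciprocal : set Z2Z3 :=
  [set z | exists x y, [/\ order2 x, order2 y, x != y & z = x * y]].

(* [true] stands for the sign [+1] and [false] for [-1]. *)
Definition ab_word (eps : seq bool) : Z2Z3 :=
  \prod_(e <- eps) (gen_a * (if e then gen_b else gen_b^-1)).

(* Indices are read modulo [size eps], also when [size eps <= m]. *)
Definition low_lying (m : nat) (eps : seq bool) : Prop :=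
  forall i : nat, ~ exists e : bool, forall j : nat, (j <= m)%N ->
    nth true eps ((i + j) %% size eps) = e.

Definition reciprocal_classes (n : nat) : set (set Z2Z3) :=
  [set conj_class x | x in [set x | reciprocal x /\ class_length x = n]].

Definition low_lying_classes (n m : nat) : set (set Z2Z3) :=
  [set conj_class (ab_word eps) | eps in
    [set eps | [/\ eps != [::], low_lying m eps
                 & class_length (ab_word eps) = n]]].

Lemma finite_classes (n : nat) :
  finite_set [set conj_class x | x in [set x | class_length x = n]].
Proof.
pose ev (t : n.-tuple 'I_3) : Z2Z3 :=
  \prod_(i <- t) nth 1 [:: gen_a; gen_b; gen_b^-1] i.
apply: (@sub_finite_set _ _ [set conj_class (ev t) | t in setT]); last first.
  by apply: finite_image; apply: finite_finset.
move=> _ [x xn <-]; move: xn; rewrite /= /class_length.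
case: ex_minnP => k /asboolP[_ [g _ <-] yk] _ kn.
rewrite {k}kn in yk; move: yk; rewrite /word_length.
case: ex_minnP => k /asboolP[w [wg wx] wk] _ kn; rewrite {k}kn in wk.
pose idx (y : Z2Z3) : 'I_3 := inord (index y [:: gen_a; gen_b; gen_b^-1]).
have sz : size (map idx w) == n by rewrite size_map wk.
exists (Tuple sz) => //; have -> : ev (Tuple sz) = x ^ g.
  rewrite -wx /ev big_map; apply: eq_big_seq => y /wg yg.
  have lt3 : (index y [:: gen_a; gen_b; gen_b^-1] < 3)%N by rewrite -index_mem in yg.
  by rewrite inordK // nth_index.
apply/seteqP; split=> _ [h _ <-].
  by exists (g * h) => //; rewrite conjgM.
by exists (g^-1 * h) => //; rewrite conjgM conjgK.
Qed.

Lemma finite_low_lying_reciprocal (n m : nat) :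
  finite_set (low_lying_classes n m `&` reciprocal_classes n).
Proof.
apply: sub_finite_set (finite_classes n) => _ [_ [x [_ xn] <-]].
by exists x.
Qed.

Local Open Scope ring_scope.

Definition nbonacci_poly (R : nzRingType) (m : nat) : {poly R} :=
  'X^m - \sum_(i < m) 'X^i.

Lemma nbonacci_root_unique (R : realType) (m : nat) : (2 <= m)%N ->
  exists! x : R, 0 < x /\ root (nbonacci_poly R m) x.
Proof.
move=> m2; have hE (x : R) : (nbonacci_poly R m).[x] = x ^+ m - \sum_(i < m) x ^+ i.
  by rewrite !hornerE horner_sum; congr (_ - _); apply: eq_bigr => i _; rewrite hornerXn.
have h1 : (nbonacci_poly R m).[1] <= 0.
  rewrite hE expr1n (eq_bigr (fun=> 1)) => [|i _]; last by rewrite expr1n.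
  by rewrite sumr_const card_ord subr_le0 ler1n ltnW.
have h2 : 0 <= (nbonacci_poly R m).[2].
  rewrite hE; suff -> : (2 : R) ^+ m - \sum_(i < m) 2 ^+ i = 1 by [].
  have := subrX1 (2 : R) m; rewrite (_ : 2 - 1 = 1 :> R); last by rewrite -[2]/(1 + 1) addrK.
  by rewrite mul1r => <-; rewrite opprB addrC subrK.
have h12 : (1 : R) <= 2 by rewrite ler1n.
have h01 : (nbonacci_poly R m).[1] <= 0 <= (nbonacci_poly R m).[2] by rewrite h1.
have [x /andP[x1 _] rx] := poly_ivt h12 h01.
have rE (y : R) : root (nbonacci_poly R m) y -> y ^+ m = \sum_(i < m) y ^+ i.
  by rewrite /root hE subr_eq0 => /eqP.
have uniq_lt (y z : R) : 0 < y -> root (nbonacci_poly R m) y ->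
    root (nbonacci_poly R m) z -> ~~ (y < z).
  move=> y0 /rE ey /rE ez; apply/negP => yz; have z0 := lt_trans y0 yz.
  suff : y ^+ m * \sum_(i < m) z ^+ i < z ^+ m * \sum_(i < m) y ^+ i.
    by rewrite -ez -ey mulrC ltxx.
  rewrite !mulr_sumr; apply: ltr_sum => [|i _].
    by apply/hasP; exists (Ordinal (ltnW m2)); rewrite ?mem_index_enum.
  have := ltn_ord i; move: (nat_of_ord i) => k km {i}.
  rewrite -(subnK (ltnW km)) !exprD -!mulrA.
  rewrite [z ^+ k * y ^+ k]mulrC ltr_pM2r ?mulr_gt0 ?exprn_gt0 //.
  by rewrite ltrXn2r ?ltW // -lt0n subn_gt0.
exists x; split; first by split=> //; apply: lt_le_trans x1.
move=> y [y0 ry]; apply/eqP; rewrite eq_le !leNgt.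
by rewrite !uniq_lt //; apply: lt_le_trans x1.
Qed.

Definition asymp_equiv (R : realType) (f g : nat -> R) : Prop :=
  (fun t => f t / g t) @ \oo --> (1 : R).

(* Main.v *)
Require Import Defs.
From mathcomp Require Import all_boot all_order all_fingroup all_algebra.
From mathcomp Require Import finmap all_classical all_reals all_analysis.
From mathcomp Require Import zify ring lra.
Import Order.TTheory GRing.Theory Num.Theory.
Import numFieldNormedType.Exports.

(* An order 2 element is a conjugate of a, so a reciprocal class is the class  *)
(* of the ab-word of an antipalindrome e ++ negrev e, where negrev reverses a  *)
(* sign sequence and changes its signs. Conjugate ab-words differ by a cyclic  *)
(* rotation, and the rotation orbit of an antipalindrome contains exactly two  *)
(* antipalindromes, half a period apart. The sign changes at both junctions    *)
(* of e ++ negrev e, so it is m-low lying iff the runs of e have length at     *)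
(* most m. Hence |L_{4t,m} /\ R_{4t}| is half the number of such e, which is   *)
(* the number f(t) of compositions of t with parts at most m.                 *)
(* The error f(t) - d alpha^t satisfies, besides the m-bonacci recurrence, the *)
(* relation u(t) = (2 - alpha) (u(t-1) + alpha u(t-2) + ... +                  *)
(* alpha^(m-1) u(t-m)), a weighted average because the weights sum to 1. So    *)
(* it stays in [-1/2, 1/2], where its first m values lie.                     *)

Set Implicit Arguments.
Unset Strict Implicit.
Unset Printing Implicit Defensive.

Local Open Scope classical_set_scope.

(** * Antipalindromes and their rotations *)

Section SignSequences.
Local Open Scope nat_scope.

(** Any product of two distinct involutions is, up to conjugacy, a times a conjugate of a
    ([order2_conj_a]), and hence the ab-word of a nonempty antipalindrome ([mul_a_conj_a],
    [reciprocal_conj_antipal]). Conjugacy of ab-words is rotation of the signs ([conj_ab_word_rot]),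
    and [negrev] acts on a rotation orbit as a dihedral reflection, so every class arises from
    exactly two sequences e ([antipal_rot_fiber]). This makes the count an m-bonacci number
    ([card_low_lying_reciprocal], [nbonacci_rec]). The analytic half rests on [err_average]: the
    error is a weighted average of its m predecessors, the weights being positive with sum 1 because
    alpha^m (2 - alpha) = 1. The constant d is the one for which this relation holds at the start.
    The bounds 1/2 <= d <= alpha/2 place the first m errors in [-1/2, 1/2] ([err_bound]). As alpha >
    1, a bounded error gives the asymptotic equivalence. *)

Definition negrev (e : seq bool) : seq bool := rev (map negb e).

Lemma size_negrev e : size (negrev e) = size e.
Proof. by rewrite size_rev size_map. Qed.

Lemma negrevK : involutive negrev.
Proof. by move=> e; rewrite /negrev map_rev revK -map_comp (eq_map negbK) map_id. Qed.

Lemma negrev_cat u v : negrev (u ++ v) = negrev v ++ negrev u.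
Proof. by rewrite /negrev map_cat rev_cat. Qed.

(** The dihedral relation: [negrev] conjugates the rotation by one letter into its inverse. *)
Lemma rot1_negrev_rot1 w : rot 1 (negrev (rot 1 w)) = negrev w.
Proof.
case: w => [|c w] //; rewrite rot1_cons /negrev map_rcons rev_rcons rot1_cons.
by rewrite /= rev_cons.
Qed.

(** The last letters are opposite. Geometrically, a sign-changing reflection has no axis through a
    letter. *)
Lemma negrev_neq_rot1 (w : seq bool) : w != [::] -> negrev w != rot 1 w.
Proof.
case: w => // c w _; rewrite rot1_cons /negrev /= rev_cons.
by apply/negP => /eqP/rcons_inj[_]; case: c.
Qed.

(** A fixed word has even length, since the middle letter of an odd one would equal its own
    negation; [negrev] then exchanges the two halves. *)
Lemma negrev_split w : negrev w = w -> w = take (size w)./2 w ++ negrev (take (size w)./2 w).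
Proof.
move=> Ew.
have ev : size w = (size w)./2.*2.
  rewrite -[LHS]odd_double_half; case: (boolP (odd _)) => // ow; exfalso.
  have lt_h : (size w)./2 < size w by lia.
  have := nth_rev true (s := map negb w) (n := (size w)./2).
  rewrite size_map -/(negrev w) Ew => /(_ lt_h).
  have -> : size w - (size w)./2.+1 = (size w)./2 by lia.
  by rewrite (nth_map true) //; case: (nth _ _ _).
set h := (size w)./2 in ev *.
have Ed : negrev (drop h w) = take h w.
  rewrite -{2}Ew -{2}(cat_take_drop h w) negrev_cat take_size_cat //.
  by rewrite size_negrev size_drop; lia.
by rewrite -Ed negrevK Ed cat_take_drop.
Qed.

Lemma rot_iter (T : Type) k (w : seq T) : k <= size w -> rot k w = iter k (rot 1) w.
Proof. by elim: k => [|k IH] lt; rewrite ?rot0 // rotS // IH // ltnW. Qed.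

(* A reflection [nu] reversing the dynamics of the rotation [f] and without   *)
(* "odd" axes has exactly two fixed points on each orbit that meets its axis: *)
(* [nu (f^r w) = f^r w] iff the period p divides 2r, and p is even.            *)
Lemma reflection_fixpoints (T : eqType) (f nu : T -> T) (w : T) n :
    injective f -> (forall x, f (nu (f x)) = nu x) ->
    (forall j, nu (iter j f w) != f (iter j f w)) ->
    0 < n -> iter n f w = w -> nu w = w ->
  exists2 h, iter h f w != w & nu (iter h f w) = iter h f w /\
    forall r, nu (iter r f w) = iter r f w ->
      iter r f w = w \/ iter r f w = iter h f w.
Proof.
move=> f_inj fnu noodd n0 fn nuw.
have per_ex : exists p, (0 < p) && (iter p f w == w) by exists n; rewrite n0 fn eqxx.
case: (ex_minnP per_ex) => p /andP[p0 /eqP fp] min_p.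
have iter_inj k x y : iter k f x = iter k f y -> x = y.
  by elim: k x y => [|k IH] x y //= /f_inj/IH.
have iterM k : iter (k * p) f w = w.
  by elim: k => // k IH; rewrite mulSn iterD IH.
have iter_mod k : iter k f w = iter (k %% p) f w.
  by rewrite {1}(divn_eq k p) addnC iterD iterM.
have iter_dvd k : iter k f w = w -> p %| k.
  rewrite iter_mod => fk; rewrite /dvdn; case: (posnP (k %% p)) => // k0.
  by have := min_p (k %% p); rewrite k0 fk eqxx /= => /(_ isT); rewrite leqNgt ltn_mod p0.
have nu_iter j : iter j f (nu (iter j f w)) = w.
  by elim: j => // j IH; rewrite iterSr /= fnu.
(* If p = 2q + 1, then [nu] would send the q-th iterate to the next one, which [noodd] forbids. *)
have evp : ~~ odd p.
  apply/negP => op; have := noodd p./2; case/eqP.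
  apply: (iter_inj p./2); rewrite nu_iter -iterS -iterD.
  by rewrite (_ : p./2 + p./2.+1 = p) // -[RHS]odd_double_half op; lia.
have nu_fixP r : nu (iter r f w) = iter r f w <-> p %| r.*2.
  split=> [fx|/dvdnP[k kE]]; first by apply: iter_dvd; rewrite -addnn iterD -{1}fx nu_iter.
  by apply: (iter_inj r); rewrite nu_iter -iterD addnn kE iterM.
have p2 : p = p./2.*2 by rewrite -[LHS]odd_double_half (negPf evp).
exists p./2.
  by apply/eqP => /iter_dvd /dvdn_leq; lia.
split; first by apply/nu_fixP; rewrite -p2.
move=> r /nu_fixP; rewrite {1}p2 -!muln2 dvdn_pmul2r // => /dvdnP[k ->].
have [ok|ek] := boolP (odd k); [right|left].
  have -> : k * p./2 = p./2 + k./2 * p by rewrite {2}p2 -{1}(odd_double_half k) ok; nia.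
  by rewrite iterD iterM.
by rewrite -[RHS](iterM k./2); congr (iter _ f w); rewrite {2}p2 -{1}(odd_double_half k) (negPf ek); nia.
Qed.

Definition antipal (e : seq bool) : seq bool := e ++ negrev e.

Lemma size_antipal e : size (antipal e) = (size e).*2.
Proof. by rewrite size_cat size_negrev addnn. Qed.

Lemma negrev_antipal e : negrev (antipal e) = antipal e.
Proof. by rewrite /antipal negrev_cat negrevK. Qed.

Lemma antipal_inj e e' : antipal e = antipal e' -> e = e'.
Proof.
move=> E; have /double_inj se : (size e).*2 = (size e').*2 by rewrite -!size_antipal E.
by have := congr1 (take (size e)) E; rewrite {2}se !take_size_cat.
Qed.

Lemma antipal_rot_fiber (e : seq bool) : e != [::] -> exists e1, e1 != e /\
  forall e', (exists2 k, k <= size (antipal e) & antipal e' = rot k (antipal e)) <->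
     e' \in [:: e; e1].
Proof.
move=> e0; set w := antipal e.
have w0 : w != [::] by rewrite -size_eq0 size_antipal; case: e e0 {w}.
have n0 : 0 < size w by rewrite lt0n size_eq0.
have sit k : size (iter k (rot 1) w) = size w by elim: k => //= k IH; rewrite size_rot.
have rotw : iter (size w) (rot 1) w = w by rewrite -rot_iter // rot_size.
have nood j : negrev (iter j (rot 1) w) != rot 1 (iter j (rot 1) w).
  by apply: negrev_neq_rot1; rewrite -size_eq0 sit size_eq0.
have [h fh [nuh cov]] := reflection_fixpoints (@rot_inj 1 _) rot1_negrev_rot1 nood n0 rotw
  (negrev_antipal e).
have iter_mod k : iter k (rot 1) w = iter (k %% size w) (rot 1) w.
  rewrite {1}(divn_eq k (size w)) addnC iterD; congr (iter _ _ _).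
  by elim: (_ %/ _) => // j IH; rewrite mulSn iterD IH.
pose e1 := take (size w)./2 (iter h (rot 1) w).
have e1E : antipal e1 = iter h (rot 1) w.
  by rewrite /antipal /e1 -(sit h); apply/esym/negrev_split.
exists e1; split; first by apply: contra fh => /eqP e1e; rewrite -e1E e1e.
move=> e'; split.
  case=> k kle; rewrite rot_iter // => E.
  have [||] := cov k; first by rewrite -E negrev_antipal.
    by rewrite -E => /antipal_inj ->; rewrite mem_head.
  by rewrite -E -e1E => /antipal_inj ->; rewrite !inE eqxx orbT.
rewrite !inE => /orP[] /eqP ->; first by exists 0; rewrite ?rot0.
(* Nothing bounds [h], while a rotation amount must not exceed the length. *)
exists (h %% size w); first by rewrite ltnW // ltn_mod.
by rewrite rot_iter -?iter_mod // ltnW // ltn_mod.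
Qed.

(** * Sign sequences with bounded runs *)

Section RunBounded.
Variable m : nat.

(** Stated for functions, so that it serves both the linear and the cyclic reading of a word; with
    indices taken modulo the size, the absence of such windows is [low_lying m] by unfolding. *)
Definition const_window (f : nat -> bool) i := exists b, forall j, j <= m -> f (i + j) = b.

Definition run_bounded (e : seq bool) :=
  forall i, i + m < size e -> ~ const_window (nth true e) i.

(* [extensions t r b]: the words of length [t] that may follow a run of [r]    *)
(* letters [b] without creating a run of more than [m] letters.               *)
Fixpoint extensions t r b : seq (seq bool) :=
  if t is t'.+1 then
    map (cons (~~ b)) (extensions t' 1 (~~ b)) ++
    (if r < m then map (cons b) (extensions t' r.+1 b) else [::])
  else [:: [::]].

(** By symmetry the count does not depend on the sign of the current run. For m > 0, reading off run
    lengths shows that [nb_extensions t 1] is the number of compositions of t + 1 with parts at most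
    m. *)
Fixpoint nb_extensions t r : nat :=
  if t is t'.+1 then nb_extensions t' 1 + (if r < m then nb_extensions t' r.+1 else 0)
  else 1.

(** The words have length t + 1: a free first letter, then t more. *)
Definition run_bounded_words t : seq (seq bool) :=
  map (cons true) (extensions t 1 true) ++ map (cons false) (extensions t 1 false).

Lemma size_extensions t r b : size (extensions t r b) = nb_extensions t r.
Proof.
elim: t r b => //= t IH r b; rewrite size_cat size_map IH; congr (_ + _).
by case: ifP; rewrite // size_map IH.
Qed.

Lemma size_run_bounded_words t : size (run_bounded_words t) = (nb_extensions t 1).*2.
Proof. by rewrite size_cat !size_map !size_extensions addnn. Qed.

Lemma mem_map_cons (a b : bool) (x : seq bool) s :
  (a :: x \in map (cons b) s) = (a == b) && (x \in s).
Proof.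
apply/mapP/andP => [[y ys [-> ->]]|[/eqP -> xs]]; first by rewrite eqxx.
by exists x.
Qed.

Lemma uniq_cons_cat (a : bool) s t : uniq s -> uniq t ->
  uniq (map (cons a) s ++ map (cons (~~ a)) t).
Proof.
have ci b : injective (@cons bool b) by move=> x y [].
move=> us ut; rewrite cat_uniq !map_inj_uniq // us ut andbT; apply/hasPn => _ /mapP[x _ ->].
by rewrite mem_map_cons; case: a.
Qed.

Lemma uniq_extensions t r b : uniq (extensions t r b).
Proof.
elim: t r b => //= t IH r b; case: ifP => _.
  by rewrite -{3}[b]negbK; apply: uniq_cons_cat.
by rewrite cats0 map_inj_uniq // => x y [].
Qed.

Lemma uniq_run_bounded_words t : uniq (run_bounded_words t).
Proof. by apply: (@uniq_cons_cat true); apply: uniq_extensions. Qed.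

Lemma run_bounded_nseq r b : r <= m -> run_bounded (nseq r b).
Proof. by move=> rm i; rewrite size_nseq; lia. Qed.

(** A window of m + 1 letters does not fit into the initial run, and one that starts there sees the
    sign change at position r. *)
Lemma run_bounded_nseq_neg r b e : r <= m ->
  run_bounded (nseq r b ++ ~~ b :: e) <-> run_bounded (~~ b :: e).
Proof.
move=> rm; split=> H i lt_i [c wc].
  apply: (H (r + i)); first by rewrite size_cat size_nseq; lia.
  exists c => j jm; rewrite -(wc j jm) nth_cat size_nseq -addnA ltnNge leq_addr /=.
  by rewrite addKn.
rewrite size_cat size_nseq in lt_i.
case: (ltnP i r) => ir.
  have := wc 0 isT; have := wc (r - i); rewrite (_ : r - i <= m); last by lia.
  rewrite addn0 subnKC ?(ltnW ir) // !nth_cat size_nseq ltnn ir subnn nth_nseq ir /= => /(_ isT) <-.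
  by case: (b).
apply: (H (i - r)); first by move: lt_i; rewrite /=; lia.
exists c => j jm; rewrite -(wc j jm) nth_cat size_nseq ltnNge (leq_trans ir) ?leq_addr //=.
by congr (nth _ _ _); lia.
Qed.

Lemma mem_extensions t r b e : 0 < r <= m ->
  e \in extensions t r b <-> size e = t /\ run_bounded (nseq r b ++ e).
Proof.
elim: t r b e => [|t IH] r b e /andP[r0 rm].
  rewrite inE; split=> [/eqP ->|[/size0nil ->]] //.
  by split=> //; rewrite cats0; apply: run_bounded_nseq.
have m0 : 0 < 1 <= m by lia.
case: e => [|a e] /=.
  split=> [|[]] //; rewrite mem_cat => /orP[|]; first by case/mapP.
  by case: ifP => // _ /mapP[].
rewrite mem_cat mem_map_cons; case: (eqVneq a b) => [->|ab].
  have -> : (b == ~~ b) = false by case: (b).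
  have cons_nseq : nseq r b ++ b :: e = nseq r.+1 b ++ e.
    by rewrite -cat_rcons; congr (_ ++ _); elim: (r) => //= k ->.
  case: ltnP => rm' /=.
    rewrite mem_map_cons eqxx /= IH ?rm' //; rewrite cons_nseq.
    by split=> [[-> ?]|[[->] ?]].
  (* Here r = m, so one more letter [b] creates a forbidden window at position 0. *)
  split=> // -[_]; rewrite cons_nseq => H; exfalso.
  apply: (H 0); first by rewrite size_cat size_nseq; lia.
  exists b => j jm; rewrite add0n nth_cat size_nseq ltnS (leq_trans jm) //.
  by rewrite nth_nseq ltnS (leq_trans jm).
have -> : a = ~~ b by case: a b ab => [] [].
rewrite eqxx /= run_bounded_nseq_neg //.
have -> : (~~ b :: e \in if r < m then map (cons b) (extensions t r.+1 b) else [::]) = false.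
  by case: ifP => // _; rewrite mem_map_cons; case: (b).
rewrite orbF IH //=.
by split=> [[-> ?]|[[->] ?]].
Qed.

Lemma mem_run_bounded_words t e : 0 < m ->
  e \in run_bounded_words t <-> size e = t.+1 /\ run_bounded e.
Proof.
move=> m0; rewrite mem_cat; case: e => [|a e].
  by split=> [|[]] // /orP[] /mapP[].
rewrite !mem_map_cons -/(nseq 1 a ++ e).
have -> : (a == true) && (e \in extensions t 1 true) || (a == false) && (e \in extensions t 1 false)
   = (e \in extensions t 1 a) by case: a; rewrite ?orbF.
by rewrite mem_extensions //=; split=> [[-> ?]|[[->] ?]].
Qed.

(* The sign changes at both junctions of [antipal e] keep its cyclic runs      *)
(* inside [e] or inside [negrev e].                                           *)
Lemma antipal_run_bounded (e : seq bool) : e != [::] ->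
  (forall i, ~ const_window (fun k => nth true (antipal e) (k %% size (antipal e))) i)
    <-> run_bounded e.
Proof.
move=> e0; have t0 : 0 < size e by case: e e0.
set t := size e in t0 *; rewrite size_antipal -/t.
have wl k : k < t -> nth true (antipal e) (k %% t.*2) = nth true e k.
  by move=> kt; rewrite modn_small ?nth_cat ?kt //; lia.
have wr k : k < t -> nth true (antipal e) ((t + k) %% t.*2) = ~~ nth true e (t.-1 - k).
  move=> kt; rewrite modn_small; last by lia.
  rewrite nth_cat -/t ltnNge leq_addr /= addKn /negrev nth_rev size_map -/t //.
  by rewrite (nth_map true) -/t; [congr (~~ nth _ _ _); lia|lia].
split=> H i.
  rewrite -/t => it [b wb]; apply: (H i); exists b => j jm /=; rewrite wl ?wb //; lia.
case=> b wb.
have {wb} wb j : j <= m -> nth true (antipal e) ((i %% t.*2 + j) %% t.*2) = b.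
  by move=> jm; rewrite modnDml wb.
have : i %% t.*2 < t.*2 by rewrite ltn_mod; lia.
move: (i %% t.*2) wb => {}i wb it2.
case: (ltnP i t) => it.
  case: (ltnP (i + m) t) => imt.
    by apply: (H i) => //; exists b => j jm; rewrite -wl ?wb //; lia.
  (* The window crosses the middle, where the letters at t - 1 and t are opposite. *)
  have w1 := wb (t.-1 - i); rewrite subnKC in w1; last by lia.
  have w2 := wb (t - i); rewrite subnKC in w2; last by lia.
  by have := wr 0 t0; rewrite addn0 subn0 w2 -?wl ?w1; [case: (b)|lia|lia|lia].
case: (ltnP (i + m) t.*2) => imt.
  (* The window lies in [negrev e]; its mirror image in [e] starts at this position and has the
     opposite sign. *)
  apply: (H (t.*2.-1 - (i + m))); first by rewrite -/t; lia.
  exists (~~ b) => j jm; rewrite -(wb (m - j)) ?leq_subr //.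
  have -> : i + (m - j) = t + (i + (m - j) - t) by lia.
  by rewrite wr ?negbK; [congr nth; lia|lia].
(* The window wraps around, and the letters at 2t - 1 and at 2t, that is 0, are opposite. *)
have w1 := wb (t.*2.-1 - i); rewrite subnKC in w1; last by lia.
have w2 := wb (t.*2 - i); rewrite subnKC in w2; last by lia.
have tl : t.-1 < t by lia.
have := wr t.-1 tl; rewrite (_ : t + t.-1 = t.*2.-1); last by lia.
by rewrite subnn -wl // mod0n -(modnn t.*2) w2 ?w1; [case: (b)|lia|lia].
Qed.
End RunBounded.

End SignSequences.

(** * Normal forms and conjugacy in the free product *)

Section FreeProductWords.
Local Open Scope group_scope.

Lemma fp_word_inj (x y : Z2Z3) : fp_word x == fp_word y -> x = y.
Proof. by move/eqP/val_inj. Qed.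

Definition bsign (c : bool) : Z2Z3 := if c then gen_b else gen_b^-1.

(** An alternating product of a and b^(+1 or -1) is an ab-word except for a possible leading power
    of b ([p]) and a possible trailing a ([q]). *)
Definition normal_form (p : option bool) (u : seq bool) (q : bool) : Z2Z3 :=
  oapp bsign 1 p * ab_word u * (if q then gen_a else 1).

Lemma mul_gen_aa : gen_a * gen_a = 1.
Proof. exact: fp_word_inj. Qed.

Lemma inv_gen_a : gen_a^-1 = gen_a.
Proof. exact: fp_word_inj. Qed.

Lemma mul_gen_aaK x : gen_a * (gen_a * x) = x.
Proof. by rewrite mulgA mul_gen_aa mul1g. Qed.

Lemma bsignV c : (bsign c)^-1 = bsign (~~ c).
Proof. by case: c; rewrite /= ?invgK. Qed.

Lemma bsignM c d : bsign c * bsign d = if c == d then bsign (~~ c) else 1.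
Proof. by case: c d => [] []; apply: fp_word_inj. Qed.

Lemma ab_word_nil : ab_word [::] = 1.
Proof. by rewrite /ab_word big_nil. Qed.

Lemma ab_word_cons c u : ab_word (c :: u) = gen_a * (bsign c * ab_word u).
Proof. by rewrite /ab_word big_cons mulgA. Qed.

Lemma ab_word_cat u v : ab_word (u ++ v) = ab_word u * ab_word v.
Proof. by rewrite /ab_word big_cat. Qed.

Lemma ab_word_rcons u c : ab_word (rcons u c) = ab_word u * (gen_a * bsign c).
Proof. by rewrite -cats1 ab_word_cat ab_word_cons ab_word_nil mulg1. Qed.

Lemma ab_word_flatten_nseq n u : ab_word (flatten (nseq n u)) = ab_word u ^+ n.
Proof. by elim: n => [|n IH] /=; rewrite ?ab_word_nil // ab_word_cat IH expgS. Qed.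

(** Inversion reverses the syllables and changes the signs, leaving each a after its power of b;
    conjugation by a restores the order. This is where [negrev] enters. *)
Lemma ab_wordV u :
  (ab_word u)^-1 = gen_a * (ab_word (negrev u) * gen_a).
Proof.
elim: u => [|c u IH]; first by rewrite ab_word_nil mul1g mul_gen_aa invg1.
by rewrite ab_word_cons !invMg IH bsignV inv_gen_a /negrev /= rev_cons ab_word_rcons -!mulgA.
Qed.

Lemma normal_form_mull_a p u q :
  exists p' u' q', gen_a * normal_form p u q = normal_form p' u' q'.
Proof.
rewrite /normal_form; case: p => [c|] /=.
  by exists None, (c :: u), q; rewrite /= ab_word_cons mul1g !mulgA.
case: u => [|c u].
  exists None, [::], (~~ q); rewrite ab_word_nil !mul1g.
  by case: q; rewrite /= ?mul_gen_aa ?mulg1.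
by exists (Some c), u, q; rewrite ab_word_cons mul1g -!mulgA mul_gen_aaK.
Qed.

Lemma normal_form_mull_b d p u q :
  exists p', bsign d * normal_form p u q = normal_form p' u q.
Proof.
rewrite /normal_form; case: p => [c|] /=; last by exists (Some d); rewrite mul1g !mulgA.
rewrite !mulgA bsignM; case: eqP => _; last by exists None.
by exists (Some (~~ d)).
Qed.

Lemma normal_formP x : exists p u q, x = normal_form p u q.
Proof.
have [n /asboolP[w [wg <-] _]] := word_ex x.
elim: w wg {n} => [|y w IH] wg.
  by exists None, [::], false; rewrite big_nil /normal_form ab_word_nil !mulg1.
have [|p [u [q E]]] := IH; first by move=> z zw; apply: wg; rewrite inE zw orbT.
rewrite big_cons E.
have := wg y; rewrite mem_head !inE => /(_ isT)/or3P[] /eqP ->.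
- exact: normal_form_mull_a.
- by have [p' ->] := normal_form_mull_b true p u q; exists p', u, q.
- by have [p' ->] := normal_form_mull_b false p u q; exists p', u, q.
Qed.

Definition syl_a : 'Z_2 + 'Z_3 := inl Zp1.
Definition syl_b (c : bool) : 'Z_2 + 'Z_3 := inr (if c then Zp1 else Zp1^-1).

Lemma fp_wordM (x y : Z2Z3) : fp_word (x * y) = word_mul x y.
Proof. by []. Qed.

Lemma fp_word_bsign c : fp_word (bsign c) = [:: syl_b c].
Proof. by case: c. Qed.

Lemma fp_word_normal_form p u q : fp_word (normal_form p u q) =
  (if p is Some c then [:: syl_b c] else [::]) ++
  flatten [seq [:: syl_a; syl_b c] | c <- u] ++ (if q then [:: syl_a] else [::]).
Proof.
pose W u' := flatten [seq [:: syl_a; syl_b c] | c <- u'] ++ (if q then [:: syl_a] else [::]).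
have Wb c u' : word_cons (syl_b c) (W u') = syl_b c :: W u'.
  by rewrite /W; case: u' => [|d u']; case: (q); case: c.
have EW u' : fp_word (ab_word u' * (if q then gen_a else 1)) = W u'.
  elim: u' => [|c u' IH]; first by rewrite ab_word_nil mul1g /W; case: (q).
  rewrite ab_word_cons -!mulgA fp_wordM fp_wordM fp_word_bsign IH.
  by rewrite /word_mul [foldr _ _ [:: syl_b c]]/= Wb.
rewrite /normal_form -mulgA fp_wordM EW -/(W u).
by case: p => [c|] //=; rewrite fp_word_bsign /= Wb.
Qed.

Lemma ab_word_normal_form u : ab_word u = normal_form None u false.
Proof. by rewrite /normal_form mulg1 mul1g. Qed.

Lemma ab_word_inj : injective ab_word.
Proof.
move=> u v /(congr1 (@fp_word _ _)); rewrite !ab_word_normal_form !fp_word_normal_form /= !cats0.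
elim: u v => [|c u IH] [|d v] //= [cd /IH ->]; congr (_ :: _).
by case: c d cd => [] [].
Qed.

Lemma size_fp_word_normal_form p u q :
  size (fp_word (normal_form p u q)) = (isSome p + (size u).*2 + q)%N.
Proof.
rewrite fp_word_normal_form !size_cat size_flatten /shape -map_comp /=.
have -> : sumn [seq 2%N | _ <- u] = (size u).*2 by elim: u => //= _ u ->.
by case: p => [c|]; case: q; rewrite /=; lia.
Qed.

(** * Word length *)

Lemma size_word_cons (G H : groupType) (x : G + H) s : (size (word_cons x s) <= (size s).+1)%N.
Proof.
rewrite /word_cons; case: ifP => // _; case: s => [|y s] //.
by case: (syl_mul x y) => [z|] //=; case: ifP => //=; lia.
Qed.

Lemma size_fp_wordM (x y : Z2Z3) :
  (size (fp_word (x * y)%g) <= size (fp_word x) + size (fp_word y))%N.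
Proof.
rewrite fp_wordM /word_mul; elim: (fp_word x) => //= z s IH.
by apply: leq_trans (size_word_cons _ _) _; rewrite addSn ltnS.
Qed.

(** Each syllable of a normal form is a single generator, which gives one inequality; the other
    holds because the number of syllables is subadditive and is 1 on generators. *)
Lemma word_lengthE x : word_length x = size (fp_word x).
Proof.
rewrite /word_length; case: ex_minnP => n /asboolP[w [wg <-] <-] min_n.
apply/eqP; rewrite eqn_leq; apply/andP; split.
  apply: min_n; apply/asboolP.
  set x' := \prod_(y <- w) y; have [p [u [q ->]]] := normal_formP x'.
  exists ((if p is Some c then [:: bsign c] else [::]) ++ flatten [seq [:: gen_a; bsign c] | c <- u]
     ++ (if q then [:: gen_a] else [::])); last first.
    rewrite size_fp_word_normal_form !size_cat size_flatten /shape -map_comp /=.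
    have -> : sumn [seq 2%N | _ <- u] = (size u).*2 by elim: u => //= _ u ->.
    by case: p => [c|]; case: q; rewrite /=; lia.
  have gbsign c : bsign c \in [:: gen_a; gen_b; gen_b^-1] by case: c; rewrite !inE eqxx ?orbT.
  split.
    move=> z; rewrite !mem_cat => /or3P[].
    - by case: p => // c; rewrite inE => /eqP ->.
    - case/flatten_mapP => c _; rewrite !inE => /orP[/eqP ->|/eqP ->]; first by rewrite eqxx.
      by have := gbsign c; rewrite !inE.
    - by case: q => //; rewrite inE => /eqP ->; rewrite mem_head.
  rewrite !big_cat /= big_flatten big_map /normal_form -mulgA; congr (_ * (_ * _)).
  - by case: p => [c|]; rewrite ?big_seq1 ?big_nil.
  - by rewrite /ab_word; apply: eq_bigr => c _; rewrite big_cons big_seq1.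
  - by case: q; rewrite ?big_seq1 ?big_nil.
elim: w wg {min_n} => [|y w IH] wg; first by rewrite big_nil.
rewrite big_cons; apply: leq_trans (size_fp_wordM _ _) _; apply: (@leq_add _ _ 1 (size w)).
  have := wg y; rewrite mem_head !inE => /(_ isT)/or3P[] /eqP -> //.
by apply: IH => z zw; apply: wg; rewrite inE zw orbT.
Qed.

Lemma word_lengthM x y : (word_length (x * y)%g <= word_length x + word_length y)%N.
Proof. by rewrite !word_lengthE; apply: size_fp_wordM. Qed.

Lemma word_lengthX x n : (word_length (x ^+ n)%g <= n * word_length x)%N.
Proof.
elim: n => [|n IH]; first by rewrite expg0 word_lengthE.
by rewrite expgS mulSn; apply: leq_trans (word_lengthM _ _) _; rewrite leq_add2l.
Qed.

Lemma word_lengthV x : word_length x^-1%g = word_length x.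
Proof. by rewrite !word_lengthE /= /word_inv size_rev size_map. Qed.

Lemma word_length_normal_form p u q :
  word_length (normal_form p u q) = (isSome p + (size u).*2 + q)%N.
Proof. by rewrite word_lengthE size_fp_word_normal_form. Qed.

Lemma word_length_ab u : word_length (ab_word u) = (size u).*2.
Proof. by rewrite ab_word_normal_form word_length_normal_form /= addn0. Qed.

Lemma word_length_b_ab c u : word_length (bsign c * ab_word u) = (size u).*2.+1.
Proof.
by have := word_length_normal_form (Some c) u false; rewrite /normal_form mulg1 addn0.
Qed.

Lemma word_length_ab_a u : word_length (ab_word u * gen_a) = (size u).*2.+1.
Proof.
by have := word_length_normal_form None u true; rewrite /normal_form mul1g add0n addn1.
Qed.

Lemma word_length_bsign c : word_length (bsign c) = 1%N.
Proof. by rewrite word_lengthE fp_word_bsign. Qed.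

Lemma word_length_a : word_length gen_a = 1%N.
Proof. by rewrite word_lengthE. Qed.

(** * Conjugacy of ab-words: class length and rotation *)

Lemma conj_class_refl x : conj_class x x.
Proof. by exists 1 => //; rewrite conjg1. Qed.

Lemma conj_class_eqP x y : conj_class x = conj_class y <-> exists g, x ^ g = y.
Proof.
split=> [xy|[g <-]].
  have : conj_class x y by rewrite xy; apply: conj_class_refl.
  by case=> g _ <-; exists g.
apply/seteqP; split=> _ [h _ <-].
  by exists (g^-1 * h) => //; rewrite conjgM conjgK.
by exists (g * h) => //; rewrite conjgM.
Qed.

Lemma class_length_conj x g : class_length (x ^ g) = class_length x.
Proof.
have E : conj_class (x ^ g) = conj_class x by apply/esym/conj_class_eqP; exists g.
rewrite /class_length; case: ex_minnP => k /asboolP kP kmin.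
case: ex_minnP => l /asboolP lP lmin; rewrite E in kP.
by apply/eqP; rewrite eqn_leq kmin ?lmin //; apply/asboolP; rewrite ?E.
Qed.

(* For every n, the n-th powers of [ab_word u] and of its conjugate by g       *)
(* differ in length by at most 2 |g|.                                         *)
Lemma class_length_ab u : class_length (ab_word u) = (size u).*2.
Proof.
rewrite /class_length; case: ex_minnP => k /asboolP[_ [g _ <-] <-] min_k.
apply/eqP; rewrite eqn_leq min_k ?andbT; last first.
  by apply/asboolP; exists (ab_word u); [exact: conj_class_refl|rewrite word_length_ab].
rewrite leqNgt; apply/negP => lt_u.
set y := ab_word u ^ g in lt_u; set l := word_length g.
(* A shorter conjugate would give n <= 2l after comparing the lengths of n-th powers, so n = 2l + 1
   is enough. *)
pose n := (l + l).+1.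
have : (word_length (ab_word u ^+ n)%g <= l + (n * word_length y + l))%N.
  have -> : ab_word u ^+ n = g * (y ^+ n * g^-1).
    by rewrite /y -conjXg conjgE !mulgA mulgV mul1g mulgK.
  apply: leq_trans (word_lengthM _ _) _; rewrite leq_add2l.
  apply: leq_trans (word_lengthM _ _) _; rewrite word_lengthV leq_add2r.
  exact: word_lengthX.
rewrite -ab_word_flatten_nseq word_length_ab size_flatten /shape map_nseq sumn_nseq.
by have := leq_mul2l n (word_length y).+1 (size u).*2; rewrite lt_u orbT /n; nia.
Qed.

(** A Euclidean descent: copies of [e] are stripped from the front of [u] until [u] is a proper
    prefix of [e], and its length is then the rotation amount. *)
Lemma cat_comm_rot (T : eqType) (e e' u : seq T) :
  e ++ u = u ++ e' -> exists2 k, (k <= size e)%N & e' = rot k e.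
Proof.
have [n] := ubnP (size u); elim: n e e' u => // n IH e e' u ltn E.
have se : size e = size e' by have := congr1 size E; rewrite !size_cat; lia.
case: e E se => [|x e] E se; first by exists 0 => //; case: e' se {E}.
case: (leqP (size (x :: e)) (size u)) => le_eu.
  have Eu : u = (x :: e) ++ drop (size (x :: e)) u.
    rewrite -{1}[u](cat_take_drop (size (x :: e))); congr (_ ++ _).
    by have := congr1 (take (size (x :: e))) E; rewrite take_size_cat // takel_cat.
  apply: (IH (x :: e) e' (drop (size (x :: e)) u)); first by rewrite size_drop /=; rewrite /= in le_eu; lia.
  by move: E; rewrite {2}Eu -catA => /eqP; rewrite eqseq_cat // eqxx => /eqP <-.
exists (size u); first exact: ltnW.
have Ee : x :: e = u ++ drop (size u) (x :: e).
  rewrite -{1}[x :: e](cat_take_drop (size u)); congr (_ ++ _).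
  by have := congr1 (take (size u)) E; rewrite [RHS]take_size_cat // takel_cat // ltnW.
move: E; rewrite /rot {1}Ee -catA => /eqP; rewrite eqseq_cat // eqxx => /eqP <-.
by rewrite {3}Ee take_size_cat.
Qed.

(** With the conjugator in normal form, an ab-word or the inverse of one reduces the claim to
    [cat_comm_rot]. In the two mixed cases one side of [E] is reduced and of odd length, while on
    the other side syllables merge or cancel, so the lengths disagree. *)
Lemma conj_ab_word_rot (e e' : seq bool) g : e != [::] -> ab_word e ^ g = ab_word e' ->
  exists2 k, (k <= size e)%N & e' = rot k e.
Proof.
move=> e0 eg.
have se : size e' = size e.
  by have := class_length_ab e'; rewrite -eg class_length_conj class_length_ab => /double_inj.
have {eg} : ab_word e * g = g * ab_word e' by rewrite -eg conjgE mulKVg.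
have [[c|] [u [[] ->]]] := normal_formP g; rewrite /normal_form /= ?mulg1 ?mul1g => E.
- set w := ab_word (negrev (c :: u)).
  have gE : bsign c * ab_word u * gen_a = w^-1.
    by rewrite ab_wordV negrevK ab_word_cons -!mulgA mul_gen_aaK.
  move: E; rewrite gE => /(congr1 (fun z => w * z * w)).
  rewrite -!mulgA mulVg mulg1 mulKVg -!ab_word_cat.
  move/ab_word_inj/esym/cat_comm_rot => [k kle ->].
  (* The roles were exchanged: [e] is a rotation of [e'], so the rotation is inverted. *)
  exists (size e' - k)%N; first by rewrite size_rot leq_subr.
  by rewrite -{1}[e'](rotK k) /rotr size_rot.
- exfalso; case: (lastP e) e0 se E => // e1 d _ se E.
  have := word_length_b_ab c (u ++ e').
  rewrite ab_word_cat mulgA -E ab_word_rcons !mulgA.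
  rewrite -(mulgA _ (bsign d)) bsignM size_cat se size_rcons; set r := (if _ then _ else _).
  have := word_lengthM (ab_word e1 * gen_a * r) (ab_word u).
  have := word_lengthM (ab_word e1 * gen_a) r.
  have := word_lengthM (ab_word e1) gen_a.
  rewrite !word_length_ab word_length_a.
  have : (word_length r <= 1)%N by rewrite /r; case: ifP => _; rewrite ?word_length_bsign // word_lengthE.
  move: (word_length (_ * _ * _ * _)) (word_length (_ * r)) (word_length (_ * _)) (word_length r).
  by move=> A B C D; rewrite !doubleD !doubleS; lia.
- exfalso; case: e' se E => [|d e1] /= se E; first by rewrite (eqP (_ : e == [::])) // -size_eq0 -se in e0.
  have := word_length_ab_a (e ++ u).
  rewrite ab_word_cat -mulgA E ab_word_cons -mulgA mul_gen_aaK mulgA.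
  rewrite size_cat -se.
  have := word_lengthM (ab_word u * bsign d) (ab_word e1).
  have := word_lengthM (ab_word u) (bsign d).
  rewrite word_length_bsign !word_length_ab.
  move: (word_length (_ * _ * _)) (word_length (_ * _)) => A B.
  by rewrite !doubleD !doubleS; lia.
- by apply: (@cat_comm_rot _ e e' u); apply: ab_word_inj; rewrite !ab_word_cat.
Qed.

Lemma ab_word_rot_conj k e : exists g, ab_word e ^ g = ab_word (rot k e).
Proof.
exists (ab_word (take k e)); rewrite -{1}(cat_take_drop k e) /rot !ab_word_cat.
by rewrite conjgE -!mulgA mulKg.
Qed.

(** * Involutions and their products *)

Lemma order2_conj x g : order2 x -> order2 (x ^ g).
Proof. by case=> x1 x2; rewrite /order2 conjg_eq1 x1 -conjXg x2 conj1g. Qed.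

Lemma order2_a : order2 gen_a.
Proof. by split; [apply/eqP => /(congr1 word_length); rewrite !word_lengthE|exact: mul_gen_aa]. Qed.

Lemma ab_word_not_order2 u : ~ order2 (ab_word u).
Proof.
case=> /eqP u1; rewrite -ab_word_flatten_nseq => /(congr1 word_length).
rewrite word_length_ab word_lengthE /= cats0 size_cat => u0; apply: u1.
by rewrite (_ : u = [::]) ?ab_word_nil //; apply: size0nil; lia.
Qed.

Lemma conj_a (x : Z2Z3) : x ^ gen_a = gen_a * (x * gen_a).
Proof. by rewrite conjgE inv_gen_a. Qed.

Lemma order2_conj_a x : order2 x -> exists g, x = gen_a ^ g.
Proof.
have back (y g : Z2Z3) : (exists h, y ^ g = gen_a ^ h) -> exists h, y = gen_a ^ h.
  by case=> h yg; exists (h * g^-1); rewrite conjgM -yg conjgK.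
have [p [u [q ->]]] := normal_formP x.
have [n] := ubnP (size u); elim: n p u q => // n IH p u q ltn.
case: p q => [c|] [] o2.
- case: (@ab_word_not_order2 (c :: u)); have := order2_conj gen_a o2; rewrite conj_a.
  by rewrite /normal_form /= ab_word_cons -!mulgA mul_gen_aa mulg1.
- case: (lastP u) ltn o2 => [_|{}u d ltn] o2.
    case: o2 => _ /(congr1 word_length); rewrite /normal_form ab_word_nil /= !mulg1 expgS expg1.
    by rewrite bsignM eqxx word_length_bsign word_lengthE.
  have E : normal_form (Some c) (rcons u d) false ^ bsign c =
      ab_word u * (gen_a * (bsign d * bsign c)).
    by rewrite conjgE /normal_form ab_word_rcons mulg1 -!mulgA mulKg.
  have := order2_conj (bsign c) o2; rewrite E bsignM => o2'; apply: (back _ (bsign c)).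
  move: o2'; rewrite E bsignM; case: eqP => _ o2'.
    by case: (@ab_word_not_order2 (rcons u (~~ d))); rewrite ab_word_rcons.
  have NE : ab_word u * (gen_a * 1) = normal_form None u true.
    by rewrite /normal_form mul1g mulg1.
  rewrite NE in o2' *; apply: IH o2'.
  by move: ltn; rewrite size_rcons ltnS.
- case: u ltn o2 => [_ _|c u ltn o2]; first by exists 1; rewrite /normal_form ab_word_nil !mul1g conjg1.
  apply: (back _ gen_a); have := order2_conj gen_a o2.
  have -> : normal_form None (c :: u) true ^ gen_a = normal_form (Some c) u false.
    by rewrite conj_a /normal_form /= mul1g ab_word_cons -!mulgA mul_gen_aa mul_gen_aaK.
  by apply: IH.
- by case: (@ab_word_not_order2 u); rewrite ab_word_normal_form.
Qed.

Lemma ab_word_antipal e : ab_word (antipal e) = ab_word e * gen_a * (ab_word e)^-1 * gen_a.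
Proof.
by rewrite ab_wordV ab_word_cat -!mulgA mul_gen_aa mul_gen_aaK mulg1.
Qed.

Lemma reciprocal_antipal_word (e : seq bool) : e != [::] -> reciprocal (ab_word (antipal e)).
Proof.
move=> e0; exists (gen_a ^ (ab_word e)^-1), gen_a.
have E : ab_word (antipal e) = gen_a ^ (ab_word e)^-1 * gen_a.
  by rewrite ab_word_antipal conjgE invgK !mulgA.
split=> //; first exact: order2_conj order2_a; first exact: order2_a.
apply/eqP => aa; move: E; rewrite aa mul_gen_aa => /(congr1 word_length).
rewrite word_length_ab word_lengthE size_antipal /=.
by case: e e0 {aa}.
Qed.

(** A leading a in [w] does not change the conjugate of a, and a trailing a is absorbed by
    conjugating the whole product by a. So [w] may be taken to be an ab-word, whose inverse
    contributes the reversed half. *)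
Lemma mul_a_conj_a w : exists e k, (gen_a * gen_a ^ w) ^ k = ab_word (antipal e).
Proof.
have key c u : gen_a * gen_a ^ (bsign c * ab_word u) = ab_word (antipal (negrev (c :: u))).
  rewrite /antipal negrevK ab_word_cat.
  have -> : bsign c * ab_word u = gen_a * ab_word (c :: u) by rewrite ab_word_cons mul_gen_aaK.
  by rewrite conjgE invMg ab_wordV inv_gen_a -!mulgA !mul_gen_aaK.
have noq p u : exists e k, (gen_a * gen_a ^ normal_form p u false) ^ k = ab_word (antipal e).
  case: p => [c|]; first by exists (negrev (c :: u)), 1; rewrite conjg1 -key /normal_form mulg1.
  case: u => [|c u].
    by exists [::], 1; rewrite -[antipal _]/[::] /normal_form ab_word_nil !mulg1 !conjg1 mul_gen_aa.
  exists (negrev (c :: u)), 1; rewrite conjg1 -key /normal_form mulg1 mul1g ab_word_cons.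
  by rewrite (conjgM gen_a gen_a) [gen_a ^ gen_a]conj_a mul_gen_aaK.
have [p [u [q ->]]] := normal_formP w; case: q; last exact: noq.
have [e [k ek]] := noq p u; exists e, (gen_a * k); rewrite -ek conjgM; congr (_ ^ k).
have -> : normal_form p u true = normal_form p u false * gen_a by rewrite /normal_form mulg1.
rewrite conjgM; move: (gen_a ^ normal_form p u false) => y.
by rewrite !conj_a -!mulgA mul_gen_aa mulg1 mul_gen_aaK.
Qed.

Lemma reciprocal_conj_antipal z : reciprocal z ->
  exists (e : seq bool) k, e != [::] /\ z ^ k = ab_word (antipal e).
Proof.
case=> x [y [x2 y2 xy ->]].
have [g xE] := order2_conj_a x2; have [h yE] := order2_conj_a y2.
have [e [k ek]] := mul_a_conj_a (h * g^-1).
exists e, (g^-1 * k).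
have E : (x * y) ^ (g^-1 * k) = ab_word (antipal e).
  by rewrite -ek xE yE conjgM conjMg conjgK (conjgM _ h).
split=> //; apply: contra xy => /eqP e0; move: E; rewrite e0 -[antipal _]/[::] ab_word_nil => /eqP.
rewrite conjg_eq1 => /eqP xy1; apply/eqP/(mulIg y); rewrite xy1.
by case: y2 => _ <-.
Qed.

End FreeProductWords.

(** * Counting the low lying reciprocal classes *)

Section Counting.
Local Open Scope nat_scope.

Lemma nth_rot_mod (T : Type) (x0 : T) k (s : seq T) i : k <= size s -> 0 < size s ->
  nth x0 (rot k s) (i %% size s) = nth x0 s ((i + k) %% size s).
Proof.
move=> ks s0; rewrite /rot nth_cat size_drop -(modnDml i).
have : i %% size s < size s by rewrite ltn_mod.
move: (i %% size s) => {}i il; case: ltnP => ik.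
  by rewrite nth_drop addnC modn_small //; lia.
rewrite nth_take; last by lia.
rewrite (_ : i + k = (i - (size s - k)) + size s); last by lia.
by rewrite modnDr modn_small //; lia.
Qed.

Lemma low_lying_rot m k s : k <= size s -> s != [::] -> low_lying m s -> low_lying m (rot k s).
Proof.
move=> ks s0 low i [b wb]; apply: (low (i + k)); exists b => j jm.
by rewrite -(wb j jm) size_rot nth_rot_mod ?lt0n ?size_eq0 // addnAC.
Qed.

(** The class length is twice the number of signs and the antipalindrome is twice as long as [e], so
    length 4(t + 1) means that [e] has t + 1 letters. Low lying is invariant under rotation, hence
    can be tested on the antipalindrome. *)
Lemma low_lying_reciprocal_classesE m t : 0 < m ->
  low_lying_classes (4 * t.+1) m `&` reciprocal_classes (4 * t.+1) =
  [set conj_class (ab_word (antipal e)) | e in [set` run_bounded_words m t]].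
Proof.
move=> m0; apply/seteqP; split=> [_ [[eps [eps0 low len] <-] [x [xr xlen] xc]]|].
  have [e [k [e0 xe]]] := reciprocal_conj_antipal xr.
  have E : conj_class (ab_word eps) = conj_class (ab_word (antipal e)).
    by rewrite -xc; apply/conj_class_eqP; exists k.
  exists e; last exact/esym.
  have [g ge] := (conj_class_eqP _ _).1 E.
  have [j jle je] := conj_ab_word_rot eps0 ge.
  apply/mem_run_bounded_words => //; split; last first.
    by apply/antipal_run_bounded => //; rewrite je; apply: low_lying_rot.
  have := class_length_ab (antipal e); rewrite -ge class_length_conj len size_antipal.
  by move: (size e) => n; lia.
move=> _ [e /mem_run_bounded_words[] // se re <-].
have e0 : e != [::] by rewrite -size_eq0 se.
have len : class_length (ab_word (antipal e)) = 4 * t.+1.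
  by rewrite class_length_ab size_antipal se; lia.
split; last by exists (ab_word (antipal e)) => //; split=> //; apply: reciprocal_antipal_word.
exists (antipal e) => //; split=> //; first by rewrite -size_eq0 size_antipal se.
exact/antipal_run_bounded.
Qed.

Lemma card_image_two_to_one (T : eqType) (U : choiceType) (f : T -> U) (s : seq T) :
    uniq s ->
    (forall x, x \in s -> exists y, y != x /\
       forall z, z \in s /\ f z = f x <-> z \in [:: x; y]) ->
  (#|` fset_set [set f x | x in [set` s]]|).*2 = size s.
Proof.
move=> us fib.
have -> : [set f x | x in [set` s]] = [set` [fset y in map f s]%fset].
  apply/seteqP; split=> [_ [x xs <-]|y] /=; first by rewrite in_fset /=; apply: map_f.
  by rewrite in_fset => /mapP[x xs ->]; exists x.
rewrite set_fsetK card_fseq -(size_map f s) -(perm_size (perm_count_undup (map f s))).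
rewrite size_flatten /shape -map_comp -muln2 mulnC sumnE big_map.
rewrite (eq_big_seq (fun=> 2)) ?big_const_seq ?count_predT ?iter_addn_0 //.
move=> y; rewrite mem_undup => /mapP[x xs ->] /=; rewrite size_nseq count_map -size_filter.
have [y' [y'x fibx]] := fib x xs.
rewrite (perm_size (_ : perm_eq _ [:: x; y'])) //; apply: uniq_perm.
- exact: filter_uniq.
- by rewrite /= inE eq_sym y'x.
- move=> z; rewrite mem_filter /=; apply/andP/idP => [[/eqP fz zs]|/fibx[zs fz]].
    by apply/fibx.
  by rewrite zs fz eqxx.
Qed.

(** The two sequences per class cancel against the two choices of first letter in
    [run_bounded_words]. *)
Lemma card_low_lying_reciprocal m t : 0 < m ->
  #|` fset_set (low_lying_classes (4 * t.+1) m `&` reciprocal_classes (4 * t.+1))| =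
  nb_extensions m t 1.
Proof.
move=> m0; rewrite low_lying_reciprocal_classesE //; apply: double_inj.
rewrite -size_run_bounded_words.
apply: (card_image_two_to_one (f := fun e => conj_class (ab_word (antipal e)))).
  exact: uniq_run_bounded_words.
move=> x /(mem_run_bounded_words _ _ m0)[sx rx].
have x0 : x != [::] by rewrite -size_eq0 sx.
have [y [yx fib]] := antipal_rot_fiber x0; exists y; split=> // z.
have ax0 : antipal x != [::] by rewrite -size_eq0 size_antipal sx.
rewrite -fib; split.
  move=> [_ /esym/conj_class_eqP[g]]; exact: conj_ab_word_rot.
case=> k kle zk; split; last first.
  by apply/esym/conj_class_eqP; have [g ge] := ab_word_rot_conj k (antipal x); exists g; rewrite zk.
have sz : size z = t.+1.
  by have := congr1 size zk; rewrite size_rot !size_antipal sx => /double_inj.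
apply/mem_run_bounded_words => //; split=> //.
apply/antipal_run_bounded; first by rewrite -size_eq0 sz.
by rewrite zk; apply: low_lying_rot => //; apply/antipal_run_bounded.
Qed.

End Counting.

(** * The m-bonacci sequence *)

Local Open Scope ring_scope.

(* The m-bonacci sequence, preceded by its m - 1 zeros: index [t + m - 1]      *)
(* counts the compositions of t with parts at most m.                         *)
Definition nbonacci m k : nat :=
  if (k < m.-1)%N then 0 else if k == m.-1 then 1 else nb_extensions m (k - m) 1.

(** The summand for j counts the words whose current run stops at length j; the initial zeros of
    [nbonacci] cover the j for which too few letters remain. *)
Lemma nb_extensions_nbonacci m t r : (0 < r <= m)%N ->
  nb_extensions m t r = (\sum_(r <= j < m.+1) nbonacci m (t + m.-1 - (j - r)))%N.
Proof.
elim: t r => [|t IH] r /andP[r0 rm].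
  rewrite big_ltn // subnn subn0 /nbonacci ltnn eqxx big_nat_cond big1 //.
  by move=> j /andP[/andP[rj jm] _]; rewrite ifT //; lia.
rewrite /= big_ltn // subnn subn0.
have -> : nb_extensions m t 1 = nbonacci m (t.+1 + m.-1).
  rewrite /nbonacci ltnNge leq_addl /= ifF; last by lia.
  by congr nb_extensions; lia.
congr (_ + _)%N; case: ltnP => rm'; last by rewrite big_geq.
rewrite IH ?rm' // big_nat_cond [RHS]big_nat_cond; apply: eq_bigr => j /andP[/andP[rj jm] _].
by congr nbonacci; lia.
Qed.

Lemma nbonacci_rec m k : (0 < m)%N ->
  nbonacci m (k + m) = (\sum_(i < m) nbonacci m (k + i))%N.
Proof.
move=> m0; rewrite {1}/nbonacci ltnNge (_ : (m.-1 <= k + m)%N) /=; last by lia.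
rewrite ifF; last by lia.
rewrite addnK nb_extensions_nbonacci ?m0 // big_nat_rev big_add1 /= big_mkord.
by apply: eq_bigr => i _; congr nbonacci; have := ltn_ord i; lia.
Qed.

(** * The positive root, the constant d and the error term *)

Section Nbonacci.
Variables (R : realType) (m : nat) (alpha : R).
Hypotheses (hm : (2 <= m)%N) (alpha_gt0 : 0 < alpha).
Hypothesis alpha_root : root (nbonacci_poly R m) alpha.

Lemma nbonacci_rootE : alpha ^+ m = \sum_(i < m) alpha ^+ i.
Proof.
move: alpha_root; rewrite /root !hornerE horner_sum subr_eq0 => /eqP ->.
by apply: eq_bigr => i _; rewrite hornerXn.
Qed.

(** Keeping the two highest terms of the sum gives alpha^2 >= alpha + 1, so alpha is at least the
    golden ratio. *)
Lemma nbonacci_root_ge : 3 / 2 <= alpha.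
Proof.
have : alpha ^+ m >= alpha ^+ m.-1 + alpha ^+ m.-2.
  rewrite nbonacci_rootE; case: m hm => [|[|k]] //= _.
  by rewrite !big_ord_recr /= [leLHS]addrC lerD2r lerDr sumr_ge0 // => i _; rewrite exprn_ge0 // ltW.
have -> : m = m.-2.+2 by lia.
rewrite /= !exprS => H; have : 0 < alpha ^+ m.-2 by rewrite exprn_gt0.
move: H; set x := alpha ^+ _ => H x0; have {H} : alpha + 1 <= alpha * alpha.
  by rewrite -(ler_pM2r x0); move: H; lra.
by move: alpha_gt0; nra.
Qed.

Lemma nbonacci_root_exp : alpha ^+ m * (2 - alpha) = 1.
Proof.
have := subrX1 alpha m; rewrite -nbonacci_rootE; lra.
Qed.

Lemma nbonacci_root_lt2 : alpha < 2.
Proof.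
have : 0 < alpha ^+ m * (2 - alpha) by rewrite nbonacci_root_exp.
by rewrite pmulr_rgt0 ?exprn_gt0 // subr_gt0.
Qed.

Let D : R := 2 + m.+1%:R * (alpha - 2).
Let d : R := (alpha - 1) / D.

(** As alpha (2 - alpha) is the inverse of alpha^(m-1), this says m + 1 <= 2 alpha^(m-1), which
    follows by induction from alpha >= 3/2. It yields both [D] > 0 and the upper bound on [d]. *)
Lemma nbonacci_root_weight : m.+1%:R * (alpha * (2 - alpha)) <= 2.
Proof.
have al2 := nbonacci_root_lt2; have al := nbonacci_root_ge.
have H k : (k.+3)%:R <= 2 * alpha ^+ k.+1.
  elim: k => [|k IH]; first by rewrite expr1; lra.
  rewrite exprS -natr1; set x := alpha ^+ k.+1 in IH *.
  have : 3 <= k.+3%:R :> R by rewrite ler_nat.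
  by nra.
have E : alpha ^+ m.-1 * (alpha * (2 - alpha)) = 1.
  by rewrite mulrA -exprSr prednK ?nbonacci_root_exp //; lia.
have p0 : 0 < alpha * (2 - alpha) by rewrite mulr_gt0 // subr_gt0.
have [k mk] : exists k, m = k.+2 by exists m.-2; lia.
have := H k; rewrite -(ler_pM2r p0) -mulrA.
by rewrite -[k.+1]/(k.+2.-1) -mk E mulr1.
Qed.

Lemma nbonacci_denom_gt0 : 0 < D.
Proof.
have al2 := nbonacci_root_lt2; have al := nbonacci_root_ge.
have := nbonacci_root_weight; rewrite /D; set c := m.+1%:R.
have : 0 <= c :> R by rewrite ler0n.
set x := 2 - alpha; have -> : alpha - 2 = - x by rewrite opprB.
have x0 : 0 < x by rewrite subr_gt0.
move=> c0; rewrite mulrCA mulrN.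
have : 0 <= c * x by rewrite mulr_ge0 // ltW.
by nra.
Qed.

Lemma nbonacci_coef_ge : 1 / 2 <= d.
Proof.
have al2 := nbonacci_root_lt2.
rewrite /d ler_pdivlMr ?nbonacci_denom_gt0 // /D.
have : 3 <= m.+1%:R :> R by rewrite ler_nat.
by nra.
Qed.

Lemma nbonacci_coef_le : d <= alpha / 2.
Proof.
rewrite /d ler_pdivrMr ?nbonacci_denom_gt0 // /D.
by have := nbonacci_root_weight; nra.
Qed.

(** The quotient stands for alpha^(k-m+1), whose exponent is negative on the initial zeros. *)
Let err k : R := (nbonacci m k)%:R - d * (alpha ^+ k / alpha ^+ m.-1).

Lemma weights_sum1 : (2 - alpha) * (\sum_(j < m) alpha ^+ (m.-1 - j)) = 1.
Proof.
have -> : \sum_(j < m) alpha ^+ (m.-1 - j) = alpha ^+ m.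
  rewrite nbonacci_rootE (reindex_inj rev_ord_inj) /=; apply: eq_bigr => i _.
  by congr (_ ^+ _); have := ltn_ord i; lia.
by rewrite mulrC nbonacci_root_exp.
Qed.

(* The characteristic polynomial times (X - 1) is X^(m+1) - 2 X^m + 1, and    *)
(* its quotient by X - alpha has coefficients 1, -(2 - alpha) alpha^j; so the  *)
(* defect of this averaging relation is multiplied by alpha at each step.      *)
Lemma average_step (u : nat -> R) k :
    (forall j, u (j + m)%N = \sum_(i < m) u (j + i)%N) ->
  u (k.+1 + m)%N - (2 - alpha) * (\sum_(j < m) alpha ^+ (m.-1 - j) * u (k.+1 + j)%N) =
  alpha * (u (k + m)%N - (2 - alpha) * (\sum_(j < m) alpha ^+ (m.-1 - j) * u (k + j)%N)).
Proof.
move=> urec.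
(* The difference of two consecutive instances of the recurrence. *)
have u2 : u (k.+1 + m)%N = 2 * u (k + m)%N - u k.
  have E1 := urec k.+1; have E2 := urec k.
  case: m hm E1 E2 => // n _; rewrite big_ord_recr big_ord_recl /= !addn0.
  under [in X in X -> _]eq_bigr do rewrite addSnnS.
  by rewrite !addSnnS => -> ->; ring.
have S1 : \sum_(j < m) alpha ^+ (m.-1 - j) * u (k.+1 + j)%N =
    alpha * (\sum_(j < m) alpha ^+ (m.-1 - j) * u (k + j)%N) - alpha ^+ m * u k + u (k + m)%N.
  case: m hm => // n _ /=.
  rewrite big_ord_recr [in RHS]big_ord_recl /= subnn subn0 addn0 !addSnnS expr0 mul1r.
  rewrite mulrDr (mulrA alpha) -exprS [X in X - _ + _]addrC addrK mulr_sumr; congr (_ + _).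
  apply: eq_bigr => i _; rewrite mulrA -exprS addSnnS; congr (_ ^+ _ * _).
  by rewrite /bump /=; have := ltn_ord i; lia.
have : alpha ^+ m * (2 - alpha) * u k = u k by rewrite nbonacci_root_exp mul1r.
by rewrite u2 S1; lra.
Qed.

Lemma err_rec k : err (k + m) = \sum_(i < m) err (k + i).
Proof.
rewrite /err nbonacci_rec; last by lia.
rewrite natr_sum sumrB -mulr_sumr; congr (_ - _ * _).
by rewrite exprD nbonacci_rootE mulr_sumr mulr_suml; apply: eq_bigr => i _; rewrite exprD.
Qed.

(** By [average_step] it suffices to treat k = 0. There the relation reads 1 - d alpha = (2 -
    alpha)(1 - m d), which is the equation d D = alpha - 1 defining [d]. *)
Lemma err_average k :
  err (k + m) = (2 - alpha) * (\sum_(j < m) alpha ^+ (m.-1 - j) * err (k + j)).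
Proof.
apply/eqP; rewrite -subr_eq0; apply/eqP.
elim: k => [|k IH]; last by rewrite average_step ?IH ?mulr0 //; apply: err_rec.
have a0 : alpha != 0 by rewrite gt_eqF.
have ap j : alpha ^+ j != 0 by rewrite expf_neq0.
have -> : err (0 + m) = 1 - d * alpha.
  rewrite /err /nbonacci add0n ltnNge leq_pred /= ifF; last by lia.
  by rewrite subnn /= -[in alpha ^+ m](prednK (n := m)) ?exprS ?mulfK //; lia.
have -> : \sum_(j < m) alpha ^+ (m.-1 - j) * err (0 + j) = 1 - m%:R * d.
  transitivity (\sum_(j < m) (((j == m.-1 :> nat)%:R : R) - d)).
    apply: eq_bigr => j _; have jm : (j <= m.-1)%N by have := ltn_ord j; lia.
    rewrite add0n /err mulrBr; congr (_ - _).
      rewrite /nbonacci; case: ltngtP jm => // [jm|->] _; first by rewrite mulr0.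
      by rewrite subnn expr0 mul1r.
    by rewrite mulrCA [X in d * X]mulrA -exprD subnK // divff ?mulr1.
  rewrite sumrB sumr_const card_ord mulr_natl; congr (_ - _).
  have pm : (m.-1 < m)%N by lia.
  rewrite (bigD1 (Ordinal pm)) //= eqxx big1 ?addr0 // => j /eqP jm.
  by case: eqP => // E; case: jm; apply: val_inj.
have : d * D = alpha - 1 by rewrite /d divfK // gt_eqF // nbonacci_denom_gt0.
by rewrite /D -natr1; lra.
Qed.

(** Averaging preserves the bound. Among the first m values, those at the zeros have absolute value
    at most d / alpha <= 1/2, and the last one is 1 - d with 1/2 <= d <= alpha/2 < 1. *)
Lemma err_bound k : `|err k| <= 1 / 2.
Proof.
have al2 := nbonacci_root_lt2; have al := nbonacci_root_ge.
have dl := nbonacci_coef_ge; have du := nbonacci_coef_le.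
have ap j : 0 < alpha ^+ j by rewrite exprn_gt0.
have [n] := ubnP k; elim: n k => // n IH k; rewrite ltnS => kn.
case: (ltnP k m) => km; last first.
  rewrite -(subnK km) err_average normrM gtr0_norm ?subr_gt0 //.
  have w0 : 0 < 2 - alpha by rewrite subr_gt0.
  have -> : 1 / 2 = (2 - alpha) * \sum_(j < m) (alpha ^+ (m.-1 - j) * (1 / 2)) :> R.
    by rewrite -mulr_suml mulrA weights_sum1 !mul1r.
  rewrite ler_pM2l //.
  apply: le_trans (ler_norm_sum _ _ _) _; apply: ler_sum => j _.
  rewrite normrM gtr0_norm // ler_pM2l //; apply: IH.
  by have := ltn_ord j; lia.
rewrite /err /nbonacci; case: ltngtP => k1.
- have E : alpha ^+ m.-1 = alpha ^+ (m.-2 - k) * alpha * alpha ^+ k.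
    by rewrite -exprSr -exprD; congr (_ ^+ _); lia.
  have ge1 : 1 <= alpha ^+ (m.-2 - k) by rewrite exprn_ege1 //; lra.
  rewrite sub0r normrN ger0_norm; last first.
    by apply: mulr_ge0; [lra|rewrite divr_ge0 // ltW].
  rewrite mulrA ler_pdivrMr // E mulrA ler_pM2r //.
  by move: ge1; set x := alpha ^+ _; nra.
- by lia.
- by rewrite k1 divff ?gt_eqF // mulr1 ler_norml; lra.
Qed.
End Nbonacci.

Theorem theorem6p7 (R : realType) (m : nat) (alpha : R)
  (hm : (2 <= m)%N)
  (alpha_gt0 : 0 < alpha)
  (alpha_root : root (nbonacci_poly R m) alpha) :
  let d : R := (alpha - 1) / (2 + m.+1%:R * (alpha - 2)) in
  let N : nat -> nat := fun t =>
    #|` fset_set (low_lying_classes (4 * t) m `&` reciprocal_classes (4 * t))| in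
  (forall t : nat, (1 <= t)%N ->
    d * alpha ^+ t - 1 / 2 <= (N t)%:R <= d * alpha ^+ t + 1 / 2) /\
  asymp_equiv (fun t => (N t)%:R) (fun t => d * alpha ^+ t).
Proof.
move=> d N.
have ha := nbonacci_root_ge hm alpha_gt0 alpha_root.
have hd : 1 / 2 <= d := nbonacci_coef_ge hm alpha_gt0 alpha_root.
have bound t : `|(N t.+1)%:R - d * alpha ^+ t.+1| <= 1 / 2.
  have := err_bound hm alpha_gt0 alpha_root (t.+1 + m.-1).
  rewrite exprD mulfK ?expf_neq0 ?gt_eqF // /N card_low_lying_reciprocal; last by lia.
  rewrite /nbonacci ltnNge leq_addl /= ifF; last by lia.
  by rewrite (_ : (t.+1 + m.-1 - m = t)%N) //; lia.
have g0 t : 0 < d * alpha ^+ t by rewrite mulr_gt0 ?exprn_gt0 //; lra.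
split=> [[|t] // _|].
  by have := bound t; rewrite ler_distl.
rewrite /asymp_equiv.
have ainv : `|alpha^-1| < 1 by rewrite ger0_norm ?invr_ge0 1?ltW // invf_lt1 //; lra.
have zc : (fun t => alpha^-1 ^+ t) @ \oo --> (0 : R) by apply: cvg_expr.
(* Since the error is at most 1/2 <= d, dividing by d alpha^t leaves a deviation from 1 of at most
   alpha^(-t). *)
apply: (@squeeze_cvgr _ _ _ _ (fun t => 1 - alpha^-1 ^+ t) (fun t => 1 + alpha^-1 ^+ t)).
- exists 1%N => // -[|t] // _; rewrite -ler_distl.
  rewrite -[X in _ - X](divff (lt0r_neq0 (g0 t.+1))) -mulrBl normrM normfV (gtr0_norm (g0 _)).
  rewrite ler_pdivrMr // mulrCA -exprMn mulVf ?gt_eqF // expr1n mulr1.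
  exact: le_trans (bound t) hd.
- by rewrite -[X in _ --> X]subr0; apply: cvgB => //; apply: cvg_cst.
- by rewrite -[X in _ --> X]addr0; apply: cvgD => //; apply: cvg_cst.
Qed.
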